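(* Let $G=(V,E)$ be a finite undirected weighted graph with $V=\{1,\dots,n\}$ and all degrees $d_i>0$, let $d\ge1$, and let $\rho:E\to O(d)$ be given with $\rho_{ji}=\rho_{ij}^{-1}$. Let $\eta^*_G$ be the partial $\mathbb{S}^{d-1}$ frustration constant of $G$ and $\lambda_1(\mathcal{L}_1)$ the smallest eigenvalue of the normalized graph Connection Laplacian. Then $$\lambda_1(\mathcal{L}_1)\le\eta^*_G\le\sqrt{10\,\lambda_1(\mathcal{L}_1)}.$$ Furthermore, if $d=1$, the stronger inequality $\eta^*_G\le\sqrt{8\,\lambda_1(\mathcal{L}_1)}$ holds.
   Context: $G$ is a simple graph with symmetric weights $w_{ij}=w_{ji}$, $w_{ij}>0$ if $(i,j)\in E$ and $w_{ij}=0$ otherwise; $d_i=\sum_j w_{ij}$. $O(d)$ is the group of $d\times d$ real orthogonal matrices; $\mathbb{S}^{d-1}$ is the unit sphere in $\mathbb{R}^d$. Sums $\sum_{i,j}$ run over all ordered pairs of vertices (terms with $w_{ij}=0$ vanish). $W_1\in\mathbb{R}^{dn\times dn}$ is the symmetric matrix whose $(i,j)$-th $d\times d$ block is $w_{ij}\rho_{ij}$, $D_1\in\mathbb{R}^{dn\times dn}$ is block diagonal with $i$-th diagonal block $d_iI_{d\times d}$, and $\mathcal{L}_1=I-D_1^{-1/2}W_1D_1^{-1/2}$ is the normalized graph Connection Laplacian. For $v:V\to\mathbb{R}^d$ not identically zero, its frustration is $$\eta(v)=\frac12\,\frac{\sum_{i,j}w_{ij}\|v_i-\rho_{ij}v_j\|^2}{\sum_i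 d_i\|v_i\|^2}.$$ The partial $\mathbb{S}^{d-1}$ frustration constant is $\eta^*_G=\min\eta(v)$, the minimum over all $v:V\to\mathbb{S}^{d-1}\cup\{0\}$ that are not identically zero. *)

(* Defs.v *)
From HB Require Import structures.
From mathcomp Require Import all_boot all_order all_algebra.
From mathcomp Require Import all_classical all_reals all_analysis.
From mathcomp Require Import ring lra.

Set Implicit Arguments.
Unset Strict Implicit.
Unset Printing Implicit Defensive.

Import Order.TTheory GRing.Theory Num.Theory.
Import numFieldTopology.Exports numFieldNormedType.Exports.

Local Open Scope classical_set_scope.
Local Open Scope ring_scope.

Definition simple_graph n (E : rel 'I_n) : Prop :=
  symmetric E /\ irreflexive E.

Definition edge_weights (R : realType) n (E : rel 'I_n)
    (w : 'I_n -> 'I_n -> R) : Prop :=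
  [/\ forall i j, w i j = w j i,
      forall i j, E i j -> 0 < w i j
    & forall i j, ~~ E i j -> w i j = 0].

Definition deg (R : realType) n (w : 'I_n -> 'I_n -> R) (i : 'I_n) : R :=
  \sum_(j < n) w i j.

Definition orthogonal_mx (R : realType) d (A : 'M[R]_d) : Prop :=
  A *m A^T = 1%:M.

(* [rho] is a total function, but only its values on edges are constrained;
   off the edges it always occurs multiplied by a zero weight. *)
Definition edge_connection (R : realType) n d (E : rel 'I_n)
    (rho : 'I_n -> 'I_n -> 'M[R]_d) : Prop :=
  forall i j, E i j ->
    orthogonal_mx (rho i j) /\ rho j i = invmx (rho i j).

(* Euclidean norm; the library norm [`|x|] on matrices is the sup norm. *)
Definition enorm (R : realType) d (x : 'cV[R]_d) : R :=
  Num.sqrt (\sum_(k < d) x k 0 ^+ 2).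

Definition frustration (R : realType) n d (w : 'I_n -> 'I_n -> R)
    (rho : 'I_n -> 'I_n -> 'M[R]_d) (v : 'I_n -> 'cV[R]_d) : R :=
  2^-1 * ((\sum_(i < n) \sum_(j < n) w i j * enorm (v i - rho i j *m v j) ^+ 2)
          / \sum_(i < n) deg w i * enorm (v i) ^+ 2).

Definition partial_sphere_map (R : realType) n d (v : 'I_n -> 'cV[R]_d) : Prop :=
  (forall i, enorm (v i) = 1 \/ v i = 0) /\ exists i, v i <> 0.

(* The infimum is a minimum: see [eta_star_min]. *)
Definition eta_star (R : realType) n d (w : 'I_n -> 'I_n -> R)
    (rho : 'I_n -> 'I_n -> 'M[R]_d) : R :=
  inf [set frustration w rho v | v in [set v | partial_sphere_map v]].

(* The block matrices below are square of size [\sum_(i < n) d], that is,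
   n * d; the vertex is the block index. *)
Definition W1 (R : realType) n d (w : 'I_n -> 'I_n -> R)
    (rho : 'I_n -> 'I_n -> 'M[R]_d) :=
  \mxblock_(i < n, j < n) (w i j *: rho i j).

Definition D1 (R : realType) n d (w : 'I_n -> 'I_n -> R) :=
  \mxdiag_(i < n) ((deg w i)%:M : 'M[R]_d).

(* The inverse square root of [D1]: see [D1_invsqrtK]. *)
Definition D1_invsqrt (R : realType) n d (w : 'I_n -> 'I_n -> R) :=
  \mxdiag_(i < n) (((Num.sqrt (deg w i))^-1)%:M : 'M[R]_d).

Definition conn_laplacian (R : realType) n d (w : 'I_n -> 'I_n -> R)
    (rho : 'I_n -> 'I_n -> 'M[R]_d) :=
  1%:M - D1_invsqrt d w *m W1 w rho *m D1_invsqrt d w.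

(* The smallest eigenvalue of a nonempty real symmetric matrix: see
   [lambda_min_eigenvalue]; [conn_laplacian_sym] makes this applicable to
   [conn_laplacian]. *)
Definition lambda_min (R : realType) N (A : 'M[R]_N) : R :=
  inf [set a | eigenvalue A a].

Section WellDefined.
Context (R : realType).

Lemma mul_mxdiag n d (A B : 'I_n -> 'M[R]_d) :
  (\mxdiag_(i < n) A i) *m (\mxdiag_(i < n) B i) =
  \mxdiag_(i < n) (A i *m B i).
Proof.
rewrite {2}/mxdiag mul_mxdiag_mxblock; apply/eq_mxblock => i j.
by case: eqVneq => [->|]; rewrite ?conform_mx_id ?mulmx0.
Qed.

Lemma D1_invsqrtK n d (w : 'I_n -> 'I_n -> R) :
  (forall i, 0 < deg w i) ->
  D1_invsqrt d w *m D1_invsqrt d w *m D1 d w = 1%:M.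
Proof.
move=> dgt0; rewrite /D1 /D1_invsqrt !mul_mxdiag -[RHS]mxdiagZ.
apply/eq_mxdiag => i; rewrite -!scalar_mxM -expr2 exprVn sqr_sqrtr ?ltW//.
by rewrite mulVf ?gt_eqF.
Qed.

Lemma conn_laplacian_sym n d (E : rel 'I_n) (w : 'I_n -> 'I_n -> R)
    (rho : 'I_n -> 'I_n -> 'M[R]_d) :
  edge_weights E w -> edge_connection E rho ->
  (conn_laplacian w rho)^T = conn_laplacian w rho.
Proof.
move=> [wC _ w0] rhoP; have trD : (D1_invsqrt d w)^T = D1_invsqrt d w.
  by rewrite tr_mxdiag; apply/eq_mxdiag => i; rewrite tr_scalar_mx.
have trW : (W1 w rho)^T = W1 w rho.
  rewrite tr_mxblock; apply/eq_mxblock => i j; rewrite linearZ/= wC.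
  have [Eij|Eij] := boolP (E i j); last by rewrite w0 ?scale0r.
  have [orth ->] := rhoP _ _ Eij; congr (_ *: _).
  have U : rho i j \in unitmx by case: (mulmx1_unit orth).
  by rewrite -[invmx _]mulmx1 -orth mulKmx// trmxK.
by rewrite /conn_laplacian linearB/= trmx1 !trmx_mul trD trW mulmxA.
Qed.

Lemma enorm2 d (x : 'cV[R]_d) : enorm x ^+ 2 = \sum_(k < d) x k 0 ^+ 2.
Proof. by rewrite sqr_sqrtr// sumr_ge0// => i _; rewrite sqr_ge0. Qed.

Lemma enorm_ge0 d (x : 'cV[R]_d) : 0 <= enorm x.
Proof. exact: sqrtr_ge0. Qed.

Lemma enorm_eq0 d (x : 'cV[R]_d) : (enorm x == 0) = (x == 0).
Proof.
apply/idP/eqP => [|->]; last first.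
  by rewrite /enorm big1 ?sqrtr0// => k _; rewrite mxE expr0n.
rewrite -sqrf_eq0 enorm2 psumr_eq0 => [|k _]; last exact: sqr_ge0.
move=> /allP x0; apply/colP => k; apply/eqP; rewrite mxE -sqrf_eq0.
exact: x0 (mem_index_enum _).
Qed.

Lemma inf_attained (S : set R) (m : R) : S m -> lbound S m -> inf S = m.
Proof.
move=> Sm lbm; apply/eqP; rewrite eq_le; apply/andP; split.
  by apply: ge_inf => //; exists m.
by apply: lb_le_inf => //; exists m.
Qed.

Lemma continuous_sum m N (F : 'I_N -> 'rV[R]_m -> R) :
  (forall i, continuous (F i)) -> continuous (fun x => \sum_(i < N) F i x).
Proof.
by move=> Fc; apply: continuous_big => [|i _]; [exact: add_continuous|exact: Fc].
Qed.

Lemma continuous_mul m (f g : 'rV[R]_m -> R) :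
  continuous f -> continuous g -> continuous (fun x => f x * g x).
Proof. by move=> fc gc x; exact: (continuousM (fc x) (gc x)). Qed.

Lemma continuous_sub m (f g : 'rV[R]_m -> R) :
  continuous f -> continuous g -> continuous (fun x => f x - g x).
Proof. by move=> fc gc x; exact: (continuousB (fc x) (gc x)). Qed.

Lemma continuous_const m (a : R) : continuous (fun _ : 'rV[R]_m => a).
Proof. exact: cst_continuous. Qed.

Lemma continuous_at_div m (a : R) (f g : 'rV[R]_m -> R) x :
  continuous f -> continuous g -> g x != 0 ->
  {for x, continuous (fun y => a * (f y / g y))}.
Proof.
move=> fc gc gx0.
have gVc : {for x, continuous (fun y => (g y)^-1)}.
  exact: (continuousV gx0 (gc x)).
have fgc : {for x, continuous (fun y => f y / g y)}.
  exact: (continuousM (fc x) gVc).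
exact: (continuousM (@continuous_const m a x) fgc).
Qed.

Lemma compact_coord_le1 N (K : set 'rV[R]_N) :
  closed K -> (forall x, K x -> forall i, `|x 0 i| <= 1) -> compact K.
Proof.
move=> Kcl Kle; have Bco : compact [set x : 'rV[R]_N | forall i, `[(-1 : R), 1]%classic (x 0 i)].
  by apply: (@rV_compact _ _ (fun=> `[(-1 : R), 1]%classic)) => _; exact: segment_compact.
apply: (subclosed_compact Kcl Bco).
by move=> x Kx i /=; rewrite in_itv/= -ler_norml; exact: Kle.
Qed.

Lemma lambda_min_eigenvalue N (A : 'M[R]_N) :
  (0 < N)%N -> A^T = A ->
  eigenvalue A (lambda_min A) /\
  forall a, eigenvalue A a -> lambda_min A <= a.
Proof.
move=> N0 Asym.
pose q (B : 'M[R]_N) (x : 'rV[R]_N) : R := (x *m B *m x^T) 0 0.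
have qE B x : q B x = \sum_j (\sum_i x 0 i * B i j) * x 0 j.
  by rewrite /q mxE; apply: eq_bigr => j _; rewrite !mxE.
pose s := q 1%:M.
have sE x : s x = \sum_j x 0 j ^+ 2.
  by rewrite /s /q mulmx1 mxE; apply: eq_bigr => j _; rewrite mxE expr2.
have sZ B (k : R) x : q B (k *: x) = k ^+ 2 * q B x.
  rewrite /q linearZ/= -!scalemxAl -scalemxAr !mxE /=; ring.
have s_ge0 x : 0 <= s x by rewrite sE sumr_ge0// => j _; exact: sqr_ge0.
have s_eq0 x : s x = 0 -> x = 0.
  rewrite sE => /eqP; rewrite psumr_eq0 => [/allP x0|j _]; last exact: sqr_ge0.
  apply/rowP => j; apply/eqP; rewrite mxE -sqrf_eq0.
  exact: x0 (mem_index_enum _).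
have qc B : continuous (q B).
  rewrite (_ : q B = fun x => \sum_j (\sum_i x 0 i * B i j) * x 0 j); last first.
    by apply/funext => x; rewrite qE.
  apply: continuous_sum => j; apply: continuous_mul; last exact: coord_continuous.
  apply: continuous_sum => i; apply: continuous_mul; first exact: coord_continuous.
  exact: continuous_const.
pose K := [set x | s x = 1].
have Kcl : closed K.
  by apply: (preimage_closed (f := s) (D := [set x | x = 1])) => [x _|];
    [exact: qc|exact: closed_eq].
have Kco : compact K.
  apply: compact_coord_le1 => // x; rewrite /K/= sE => x1 i.
  rewrite -(@expr_le1 _ 2)// real_normK ?num_real// -x1 (bigD1 i)//= lerDl.
  by rewrite sumr_ge0// => j _; exact: sqr_ge0.
have K0 : K !=set0.
  exists (delta_mx 0 (Ordinal N0)); rewrite /K/= sE (bigD1 (Ordinal N0))//=.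
  rewrite mxE !eqxx expr1n big1 ?addr0// => j /negPf jN.
  by rewrite mxE jN andbF expr0n.
have [c + cmin] := compact_EVT_min K0 Kco (continuous_subspaceT (qc A)).
rewrite inE => c1; pose lam := q A c.
have q_ge x : lam * s x <= q A x.
  have [/s_eq0->|sx0] := eqVneq (s x) 0.
    by rewrite /s /q !mul0mx !mxE mulr0.
  have sx : 0 < s x by rewrite lt_neqAle eq_sym sx0 s_ge0.
  have /cmin : (Num.sqrt (s x))^-1 *: x \in K.
    by rewrite inE /K/= /s sZ exprVn sqr_sqrtr// mulVf.
  by rewrite sZ exprVn sqr_sqrtr// mulrC ler_pdivlMr.
have [B BE] : {B | B = A - lam%:M} by exists (A - lam%:M).
have qB x : q B x = q A x - lam * s x.
  rewrite /s /q BE mulmxBr mulmxBl mul_mx_scalar mulmx1 -scalemxAl.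
  by rewrite !mxE.
have Bsym : B^T = B by rewrite BE linearB/= tr_scalar_mx Asym.
pose y := c *m B.
have expand t : q B (c + t *: y) = 2 * t * s y + t ^+ 2 * q B y.
  have c0 : (c *m B *m c^T) 0 0 = 0.
    by rewrite -/(q B c) qB c1 mulr1 subrr.
  have cy : (y *m B *m c^T) 0 0 = s y.
    by rewrite /s /q mulmx1 {3}/y trmx_mul Bsym mulmxA.
  have yc : (c *m B *m y^T) 0 0 = s y by rewrite /s /q mulmx1.
  have trE : (c + t *: y)^T = c^T + t *: y^T.
    by apply/matrixP => i j; rewrite !mxE.
  rewrite {1}/q trE !mulmxDl !mulmxDr -!scalemxAl -!scalemxAr.
  have mxED (M1 M2 : 'M[R]_1) : (M1 + M2) 0 0 = M1 0 0 + M2 0 0 by rewrite mxE.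
  have mxEZ a (M : 'M[R]_1) : (a *: M) 0 0 = a * M 0 0 by rewrite mxE.
  rewrite !mxED !mxEZ c0 cy yc /q; ring.
have lamP : eigenvalue A lam.
  apply/eigenvalueP; exists c; last first.
    apply: contra_eq_neq c1 => ->; rewrite /s /q !mul0mx mxE.
    by rewrite eq_sym oner_eq0.
  apply/eqP; rewrite -subr_eq0 -mul_mx_scalar -mulmxBr -BE -/y; apply/eqP.
  apply: s_eq0; apply/eqP; rewrite eq_le s_ge0 andbT leNgt; apply/negP => sy0.
  have qB0 x : 0 <= q B x by rewrite qB subr_ge0.
  set P := q B y in expand; have P0 : 0 <= P by exact: qB0.
  have P1 : 0 < P + 1 by lra.
  have := qB0 (c + (- s y / (P + 1)) *: y); rewrite expand.
  rewrite (_ : _ + _ = - (s y ^+ 2 * (P + 2) / (P + 1) ^+ 2)); last first.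
    by field; rewrite gt_eqF.
  rewrite leNgt oppr_lt0 divr_gt0// ?mulr_gt0// ?exprn_gt0//; lra.
have lam_lb : lbound [set a | eigenvalue A a] lam.
  move=> a /= /eigenvalueP[x xA x0].
  have sx : 0 < s x.
    rewrite lt_neqAle s_ge0 andbT eq_sym.
    by apply: contra_neq x0 => /s_eq0.
  rewrite -(ler_pM2r sx); apply: le_trans (q_ge x) _.
  by rewrite /s /q xA mulmx1 -scalemxAl mxE.
rewrite /lambda_min (inf_attained (m := lam))//; split=> // a /lam_lb; exact.
Qed.

Lemma eta_star_min n d (w : 'I_n -> 'I_n -> R)
    (rho : 'I_n -> 'I_n -> 'M[R]_d) :
  (0 < n)%N -> (0 < d)%N -> (forall i, 0 < deg w i) ->
  (exists2 v, partial_sphere_map v & frustration w rho v = eta_star w rho) /\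
  forall v, partial_sphere_map v -> eta_star w rho <= frustration w rho v.
Proof.
move=> n0 d0 dgt0.
pose V (x : 'rV[R]_(n * d)) i : 'cV[R]_d := \col_k x 0 (mxvec_index i k).
have Vsurj v : exists x, V x = v.
  exists (mxvec (\matrix_(i, k) v i k 0)); apply/funext => i; apply/colP => k.
  by rewrite mxE mxvecE mxE.
have Vc i k : continuous (fun x => V x i k 0).
  have -> : (fun x => V x i k 0) =
      (fun x : 'rV[R]_(n * d) => x 0 (mxvec_index i k)).
    by apply/funext => x; rewrite mxE.
  exact: coord_continuous.
have sqc (f : 'rV[R]_(n * d) -> 'cV[R]_d) :
    (forall k, continuous (fun x => f x k 0)) ->
    continuous (fun x => enorm (f x) ^+ 2).
  move=> fc; under [fun x => _]eq_fun do rewrite enorm2.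
  by apply: continuous_sum => k; apply: continuous_mul; exact: fc.
have N2c i : continuous (fun x => enorm (V x i) ^+ 2) by apply: sqc => k.
have M2c i j : continuous (fun x => enorm (V x i - rho i j *m V x j) ^+ 2).
  apply: sqc => k.
  have -> : (fun x => (V x i - rho i j *m V x j) k 0) =
      (fun x => V x i k 0 - \sum_l rho i j k l * V x j l 0).
    by apply/funext => x; rewrite !mxE.
  apply: continuous_sub; first exact: Vc.
  apply: continuous_sum => l; apply: continuous_mul; last exact: Vc.
  exact: continuous_const.
pose K := [set x | partial_sphere_map (V x)].
have KE : K = [set x | 1 <= \sum_i enorm (V x i) ^+ 2] `&`
    \bigcap_i [set x | enorm (V x i) ^+ 2 * (enorm (V x i) ^+ 2 - 1) = 0].
  apply/seteqP; split=> x /=.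
    move=> [xP [i xi]]; split.
      have -> : 1 = enorm (V x i) ^+ 2 by case: (xP i) => // ->; rewrite expr1n.
      by rewrite (bigD1 i)//= lerDl sumr_ge0// => j _; exact: sqr_ge0.
    move=> j _ /=; case: (xP j) => [->|/eqP]; first by rewrite expr1n subrr mulr0.
    by rewrite -enorm_eq0 => /eqP->; rewrite expr0n mul0r.
  move=> [x1 xP]; split=> [i|].
    have /eqP := xP i I; rewrite mulf_eq0 sqrf_eq0 enorm_eq0 => /orP[/eqP|]; first by right.
    by rewrite subr_eq0 sqrp_eq1 ?enorm_ge0// => /eqP; left.
  apply: contrapT => x0; move: x1; rewrite /= big1 ?ler10// => i _.
  apply/eqP; rewrite sqrf_eq0 enorm_eq0; apply/eqP; apply: contrapT => xi.
  by apply: x0; exists i.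
have Kcl : closed K.
  rewrite KE; apply: closedI.
    apply: (preimage_closed (f := fun x => \sum_i enorm (V x i) ^+ 2)
      (D := [set z | 1 <= z])) => [x _|]; last exact: closed_ge.
    by apply: continuous_sum => i; exact: N2c.
  apply: closed_bigI => i _.
  apply: (preimage_closed (f := fun x => enorm (V x i) ^+ 2 * (enorm (V x i) ^+ 2 - 1))
      (D := [set z | z = 0])) => [x _|]; last exact: closed_eq.
  apply: continuous_mul; first exact: N2c.
  by apply: continuous_sub; [exact: N2c|exact: continuous_const].
have Kco : compact K.
  apply: compact_coord_le1 => // x [xP _] m.
  case/mxvec_indexP: m => i k.
  rewrite -(@expr_le1 _ 2)// real_normK ?num_real//.
  apply: (@le_trans _ _ (enorm (V x i) ^+ 2)).
    rewrite enorm2 (bigD1 k)//= mxE lerDl sumr_ge0// => j _; exact: sqr_ge0.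
  case: (xP i) => [->|/eqP]; first by rewrite expr1n.
  by rewrite -enorm_eq0 => /eqP->; rewrite expr0n ler01.
have K0 : K !=set0.
  have [x xE] := Vsurj (fun=> delta_mx (Ordinal d0) 0); exists x.
  have e1 : enorm (delta_mx (Ordinal d0) 0 : 'cV[R]_d) = 1.
    rewrite /enorm (bigD1 (Ordinal d0))//= mxE !eqxx expr1n big1 ?addr0 ?sqrtr1//.
    by move=> j /negPf jN; rewrite mxE jN expr0n.
  rewrite /K/= xE; split=> [i|]; first by left.
  exists (Ordinal n0); apply/eqP; by rewrite -enorm_eq0 e1 oner_eq0.
have numc : continuous (fun x => \sum_i \sum_j
    w i j * enorm (V x i - rho i j *m V x j) ^+ 2).
  apply: continuous_sum => i; apply: continuous_sum => j.
  by apply: continuous_mul; [exact: continuous_const|exact: M2c].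
have denc : continuous (fun x => \sum_i deg w i * enorm (V x i) ^+ 2).
  apply: continuous_sum => i.
  by apply: continuous_mul; [exact: continuous_const|exact: N2c].
have den0 x : x \in K -> \sum_i deg w i * enorm (V x i) ^+ 2 != 0.
  rewrite inE => -[_ [i /eqP xi]].
  rewrite gt_eqF// (bigD1 i)//= ltr_pwDl ?sumr_ge0// => [|j _].
    by rewrite mulr_gt0// exprn_gt0// lt_neqAle enorm_ge0 eq_sym enorm_eq0 xi.
  by rewrite mulr_ge0 ?sqr_ge0// ltW.
have Fc : {within K, continuous (fun x => frustration w rho (V x))}.
  apply: continuous_in_subspaceT => x xK.
  exact: (continuous_at_div numc denc (den0 x xK)).
have [c + cmin] := compact_EVT_min K0 Kco Fc; rewrite inE => Kc.
have lb v : partial_sphere_map v -> frustration w rho (V c) <= frustration w rho v.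
  by have [x <-] := Vsurj v => xP; apply: cmin; rewrite inE.
have -> : eta_star w rho = frustration w rho (V c).
  by apply: inf_attained => [|_ [v vP <-]]; [exists (V c)|exact: lb].
by split=> //; exists (V c).
Qed.

End WellDefined.

(* Main.v *)
(* A map v : V -> R^d is rounded at level u > 0 to the partial unit map v^u,
   equal to v_i/|v_i| where u <= |v_i|^2 and to 0 elsewhere.  Each nonzero v^u
   has frustration at least eta^*, and integrating this inequality in u
   replaces the product of the indicators of i and j by min(|v_i|^2, |v_j|^2).
   An edgewise AM-GM inequality with a free parameter t > 0 then bounds the
   integral by the energy of v, and for v minimizing the Rayleigh quotient it
   yields eta^* <= t lambda_1 + 1/t.  Optimizing over t gives
   eta^* <= sqrt (4 lambda_1) for every d, which covers both 10 and 8. *)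
Require Import Defs.
From HB Require Import structures.
From mathcomp Require Import all_boot all_order all_algebra.
From mathcomp Require Import all_classical all_reals all_analysis.
From mathcomp Require Import ring lra.

Set Implicit Arguments.
Unset Strict Implicit.
Unset Printing Implicit Defensive.

Import Order.TTheory GRing.Theory Num.Theory.
Import numFieldTopology.Exports numFieldNormedType.Exports.
Local Open Scope ring_scope.

(** * Scalar inequalities behind the rounding *)

(* Layer cake: the integral over u > 0 of the indicator of u <= m i is m i. *)
Lemma layer_sum_ge0 (R : realFieldType) (I : finType) (C m : I -> R) :
  (forall i, 0 <= m i) ->
  (forall u, 0 < u -> 0 <= \sum_(i | u <= m i) C i) ->
  0 <= \sum_i C i * m i.
Proof.
(* Induction on the number of positive values: a layer whose height is the least positive value
   [m j] is removed, and the remainder [m'] vanishes at [j]. *)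
have [k] := ubnP #|[set i | 0 < m i]|; elim: k m => // k IHk m mk m0 layer.
have [i0 mi0|mle0] := pickP (fun i => 0 < m i); last first.
  rewrite big1// => i _; suff -> : m i = 0 by rewrite mulr0.
  by apply/eqP; rewrite eq_le m0 andbT leNgt mle0.
case: (@arg_minP _ _ _ i0 (fun i => 0 < m i) m mi0) => j mj jmin.
(* The truncation at 0 matters only where [m i = 0], since every positive value is at least
   [m j]. *)
pose m' i := Num.max 0 (m i - m j).
have m'E i : m i = m' i + (if m j <= m i then m j else 0).
  have [mi|mi] := ltP 0 (m i).
    by rewrite /m' jmin// max_r ?subr_ge0 ?jmin// subrK.
  have mi_eq0 : m i = 0 by apply/eqP; rewrite eq_le mi m0.
  by rewrite /m' mi_eq0 leNgt mj sub0r max_l ?oppr_le0 ?ltW// addr0.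
have -> : \sum_i C i * m i =
    \sum_i C i * m' i + (\sum_(i | m j <= m i) C i) * m j.
  rewrite mulr_suml [X in _ + X]big_mkcond -big_split/=; apply: eq_bigr => i _.
  by rewrite {1}m'E mulrDr; case: ifP; rewrite ?mulr0.
apply: addr_ge0; last by rewrite mulr_ge0 ?layer.
apply: IHk => [|i|u u0]; last 1 first.
- have := layer (u + m j) (addr_gt0 u0 mj).
  congr (0 <= _); apply: eq_bigl => i.
  by rewrite /m' le_max lerBrDr [u <= 0]leNgt u0.
- rewrite ltnS in mk; apply: leq_trans mk; apply/proper_card/properP; split.
    apply/fintype.subsetP => i; rewrite !inE /m' lt_max ltxx/= subr_gt0.
    exact: lt_trans.
  by exists j; rewrite !inE ?mj// /m' subrr maxxx ltxx.
- by rewrite /m' le_max lexx.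
Qed.

(* With a = |v_i|, b = |v_j| and k the cosine of the angle between v_i and
   rho_ij v_j, the left side is the integral over u of |v^u_i - rho_ij v^u_j|^2. *)
Lemma rounding_le (R : realFieldType) (a b k t : R) :
  0 <= a -> 0 <= b -> -1 <= k -> k <= 1 -> 0 < t ->
  a ^+ 2 + b ^+ 2 - 2 * (k * Num.min (a ^+ 2) (b ^+ 2)) <=
  t * (a ^+ 2 + b ^+ 2 - 2 * (a * b * k)) + (a + b) ^+ 2 / (2 * t).
Proof.
move=> a0 b0 k1 k2 t0.
wlog ba : a b a0 b0 / b <= a.
  move=> W; have [/W->//|/ltW /W] := leP b a.
  rewrite minC [b ^+ 2 + _]addrC [b * a]mulrC [b + a]addrC; exact.
rewrite min_r ?ler_pXn2r ?nnegrE//.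
have tN : t != 0 by rewrite gt_eqF.
(* For [b <= a] both sides split into a radial part and an angular part with factor [1 - k]. [H1]
   and [H2] bound these separately, each spending half of [(a + b) ^+ 2 / (2 * t)]. *)
have H1 : (a - b) * (a + b) <= t * (a - b) ^+ 2 + (a + b) ^+ 2 / (4 * t).
  rewrite -subr_ge0 (_ : _ - _ = (2 * t * (a - b) - (a + b)) ^+ 2 / (4 * t)).
    by rewrite divr_ge0 ?sqr_ge0// mulr_ge0 ?ltW.
  by field.
have H2 : 2 * (1 - k) * b ^+ 2 <= 2 * t * (1 - k) * (a * b) + (a + b) ^+ 2 / (4 * t).
  have ab : b ^+ 2 <= a * b by rewrite expr2 ler_wpM2r.
  have b4 : 4 * b ^+ 2 / (4 * t) <= (a + b) ^+ 2 / (4 * t).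
    rewrite ler_pM2r ?invr_gt0 ?mulr_gt0//.
    nra.
  have e1 : 2 * t * (1 - k) * b ^+ 2 <= 2 * t * (1 - k) * (a * b).
    rewrite ler_wpM2l// !mulr_ge0 ?subr_ge0//; exact: ltW.
  have e2 : 2 * (1 - k) * b ^+ 2 <= 2 * t * (1 - k) * b ^+ 2 + 4 * b ^+ 2 / (4 * t).
    (* The bracket is a convex combination of [1] and [(1 - 2 * t) ^+ 2], because [-1 <= k <= 1]. *)
    rewrite -subr_ge0 (_ : _ - _ =
        b ^+ 2 * ((1 + k) / 2 + (1 - k) / 2 * (1 - 2 * t) ^+ 2) / t); last by field.
    apply: divr_ge0 (ltW t0); rewrite mulr_ge0 ?sqr_ge0// addr_ge0//; first lra.
    by rewrite mulr_ge0 ?sqr_ge0//; lra.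
  lra.
have -> : (a + b) ^+ 2 / (2 * t) = (a + b) ^+ 2 / (4 * t) + (a + b) ^+ 2 / (4 * t).
  by field.
lra.
Qed.

(** * Inner product and unit directions *)

Definition dot (R : realType) d (x y : 'cV[R]_d) : R := (x^T *m y) 0 0.

(** The quadratic form of the unnormalized connection Laplacian [D1 - W1]; [sum_edge_energy]
    identifies it with half of the numerator sum of the frustration. *)
Definition energy (R : realType) n d (w : 'I_n -> 'I_n -> R)
    (rho : 'I_n -> 'I_n -> 'M[R]_d) (v : 'I_n -> 'cV[R]_d) : R :=
  \sum_i deg w i * dot (v i) (v i)
  - \sum_i \sum_j w i j * dot (v i) (rho i j *m v j).

Definition mass (R : realType) n d (w : 'I_n -> 'I_n -> R)
    (v : 'I_n -> 'cV[R]_d) : R :=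
  \sum_i deg w i * dot (v i) (v i).

(* Equal to 0 at x = 0, because 0^-1 = 0. *)
Definition direction (R : realType) d (x : 'cV[R]_d) : 'cV[R]_d :=
  (enorm x)^-1 *: x.

Section Dot.
Context (R : realType) (d : nat).
Implicit Types (x y z : 'cV[R]_d) (a : R).

Lemma enorm2_dot x : enorm x ^+ 2 = dot x x.
Proof.
by rewrite enorm2 /dot mxE; apply: eq_bigr => k _; rewrite mxE expr2.
Qed.

Lemma dot_ge0 x : 0 <= dot x x. Proof. by rewrite -enorm2_dot sqr_ge0. Qed.

Lemma dot_eq0 x : (dot x x == 0) = (x == 0).
Proof. by rewrite -enorm2_dot sqrf_eq0 enorm_eq0. Qed.

Lemma dotC x y : dot x y = dot y x.
Proof. by rewrite /dot -[x^T *m y]trmxK trmx_mul trmxK mxE. Qed.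

Lemma dotZl a x y : dot (a *: x) y = a * dot x y.
Proof. by rewrite /dot linearZ/= -scalemxAl mxE. Qed.

Lemma dotZr a x y : dot x (a *: y) = a * dot x y.
Proof. by rewrite dotC dotZl dotC. Qed.

Lemma dotBl x y z : dot (x - y) z = dot x z - dot y z.
Proof.
by rewrite /dot [(x - y)^T]linearB/= mulmxBl [LHS]mxE [X in _ + X]mxE.
Qed.

Lemma dotBr x y z : dot x (y - z) = dot x y - dot x z.
Proof. by rewrite dotC dotBl ![dot _ x]dotC. Qed.

Lemma dotB x y : dot (x - y) (x - y) = dot x x + dot y y - 2 * dot x y.
Proof. by rewrite dotBl !dotBr [dot y x]dotC; ring. Qed.

Lemma dot_orthogonal (A : 'M[R]_d) x :
  orthogonal_mx A -> dot (A *m x) (A *m x) = dot x x.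
Proof.
by move=> /mulmx1C AA; rewrite /dot trmx_mul mulmxA -(mulmxA x^T) AA mulmx1.
Qed.

(** Cauchy-Schwarz in the unit ball, read off from the expansions of the squared norms of [x - y]
    and [x + y]. *)
Lemma dot_le1 x y : dot x x <= 1 -> dot y y <= 1 -> -1 <= dot x y <= 1.
Proof.
have := dot_ge0 (x - y); have := dot_ge0 (x - (-1) *: y).
rewrite !dotB dotZl !dotZr => h1 h2 h3 h4; apply/andP; split; lra.
Qed.

Lemma directionE x : x = enorm x *: direction x.
Proof.
have [->|x0] := eqVneq x 0; first by rewrite /direction !scaler0.
by rewrite scalerA mulfV ?scale1r// enorm_eq0.
Qed.

Lemma direction_unit x : x != 0 -> dot (direction x) (direction x) = 1.
Proof.
rewrite -enorm_eq0 => x0.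
by rewrite dotZl dotZr -enorm2_dot expr2 mulKf// mulVf.
Qed.

Lemma direction_le1 x : dot (direction x) (direction x) <= 1.
Proof.
have [->|/direction_unit->//] := eqVneq x 0.
by rewrite /direction scaler0 /dot mulmx0 mxE ler01.
Qed.

End Dot.

(** * Variational characterization of the smallest eigenvalue *)

(** At a zero [c] of a nonnegative form, a nonzero gradient [2 B c] would make the form negative a
    short step along [- B c]. *)
Lemma psd_null (R : realType) N (B : 'M[R]_N) (c : 'cV[R]_N) :
  B^T = B -> (forall x, 0 <= dot x (B *m x)) -> dot c (B *m c) = 0 ->
  B *m c = 0.
Proof.
move=> Bsym Bpsd c0; set y := B *m c.
have dotB_sym x z : dot x (B *m z) = dot z (B *m x).
  by rewrite dotC /dot trmx_mul Bsym mulmxA.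
have expand t : dot (c - t *: y) (B *m (c - t *: y)) =
    t ^+ 2 * dot y (B *m y) - 2 * t * dot y y.
  rewrite mulmxBr -scalemxAr -/y dotBl !dotBr !dotZl !dotZr.
  by rewrite (dotB_sym c y) -/y c0; ring.
apply/eqP; rewrite -dot_eq0 eq_le dot_ge0 andbT leNgt; apply/negP => y0.
(* With [s = dot y y] and [P = dot y (B *m y)], the step [s / (P + 1)] stands in for the exact
   minimizer [s / P]; the added 1 keeps the denominator positive when [P = 0]. *)
have := Bpsd (c - (dot y y / (dot y (B *m y) + 1)) *: y); rewrite expand.
have := Bpsd y; move: (dot y (B *m y)) => P P0; move: (dot y y) y0 => s s0.
have P1 : 0 < P + 1 by clear -P0; lra.
rewrite (_ : _ - _ = - (s ^+ 2 * (P + 2) / (P + 1) ^+ 2)); last first.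
  by field; rewrite gt_eqF.
rewrite leNgt oppr_lt0 divr_gt0// ?mulr_gt0// ?exprn_gt0//.
by clear -P0; lra.
Qed.

(** Compactness gives a minimizer of the form on the unit sphere, and [psd_null] makes it an
    eigenvector. The minimum is thus an eigenvalue, hence at least [lambda_min A]. *)
Lemma lambda_min_rayleigh (R : realType) N (A : 'M[R]_N) (x : 'cV[R]_N) :
  A^T = A -> lambda_min A * dot x x <= dot x (A *m x).
Proof.
move=> Asym; have [N0|] := posnP N.
  by subst N; rewrite [x]flatmx0 /dot mulmx0 !trmx0 !mul0mx !mxE mulr0.
move=> N0; pose q (z : 'rV[R]_N) := dot z^T (A *m z^T).
pose s (z : 'rV[R]_N) := dot z^T z^T.
have sE z : s z = \sum_j z 0 j * z 0 j.
  by rewrite /s /dot mxE; apply: eq_bigr => j _; rewrite !mxE.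
have sc : continuous s.
  rewrite (funext sE); apply: continuous_sum => j.
  by apply: continuous_mul; exact: coord_continuous.
have qc : continuous q.
  rewrite (_ : q = fun z => \sum_k z 0 k * \sum_l A k l * z 0 l); last first.
    apply/funext => z; rewrite /q /dot mxE; apply: eq_bigr => k _.
    by rewrite !mxE; congr (_ * _); apply: eq_bigr => l _; rewrite !mxE.
  apply: continuous_sum => k; apply: continuous_mul.
    exact: coord_continuous.
  apply: continuous_sum => l; apply: continuous_mul.
    exact: continuous_const.
  exact: coord_continuous.
pose K := [set z | s z = 1]%classic.
have Kco : compact K.
  apply: compact_coord_le1 => [|z z1 i].
    by apply: (preimage_closed (f := s) (D := [set a | a = 1]%classic)) => [z _|];
      [exact: sc|exact: closed_eq].
  rewrite -(@expr_le1 _ 2)// real_normK ?num_real// -z1 sE (bigD1 i)//= -expr2.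
  by rewrite lerDl sumr_ge0// => j _; rewrite -expr2 sqr_ge0.
have K0 : (K !=set0)%classic.
  exists (delta_mx 0 (Ordinal N0)); rewrite /K/= sE (bigD1 (Ordinal N0))//=.
  rewrite mxE !eqxx mulr1 big1 ?addr0// => j /negPf jN.
  by rewrite mxE jN andbF mulr0.
have [c + cmin] := compact_EVT_min K0 Kco (continuous_subspaceT qc).
rewrite inE /K/= => c1; pose lam := q c.
have q_ge z : lam * dot z z <= dot z (A *m z).
  have [->|z0] := eqVneq z 0; first by rewrite /dot mulmx0 trmx0 !mul0mx mxE mulr0.
  have zz : 0 < dot z z by rewrite lt_neqAle eq_sym dot_eq0 z0 dot_ge0.
  pose r := (Num.sqrt (dot z z))^-1.
  have r2 : r * r = (dot z z)^-1 by rewrite -expr2 exprVn sqr_sqrtr ?ltW.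
  have /cmin : (r *: z)^T \in K.
    by rewrite inE /K/= /s trmxK dotZl dotZr mulrA r2 mulVf ?gt_eqF.
  by rewrite {2}/q trmxK -scalemxAr dotZl dotZr mulrA r2 mulrC ler_pdivlMr.
have Bq z : dot z ((A - lam%:M) *m z) = dot z (A *m z) - lam * dot z z.
  by rewrite mulmxBl mul_scalar_mx dotBr dotZr.
have Bsym : (A - lam%:M)^T = A - lam%:M by rewrite linearB/= tr_scalar_mx Asym.
have Bc : (A - lam%:M) *m c^T = 0.
  apply: psd_null => // [z|]; first by rewrite Bq subr_ge0.
  by rewrite Bq -/(s c) c1 mulr1 subrr.
have lamP : eigenvalue A lam.
  apply/eigenvalueP; exists c; last first.
    by apply: contra_eq_neq c1 => ->; rewrite /s trmx0 (eqP (_ : dot 0 0 == 0))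
      ?dot_eq0 // eq_sym oner_neq0.
  apply/eqP; rewrite -subr_eq0 -mul_mx_scalar -mulmxBr; apply/eqP/trmx_inj.
  by rewrite trmx_mul Bsym Bc trmx0.
apply: le_trans (q_ge x); rewrite ler_wpM2r ?dot_ge0//.
exact: (lambda_min_eigenvalue N0 Asym).2.
Qed.

(** * Energy, mass and the connection Laplacian *)

Section Energy.
Context (R : realType) (n d : nat) (E : rel 'I_n).
Context (w : 'I_n -> 'I_n -> R) (rho : 'I_n -> 'I_n -> 'M[R]_d).
Hypotheses (wP : edge_weights E w) (rhoP : edge_connection E rho).
Hypotheses (deg_gt0 : forall i, 0 < deg w i).
Hypotheses (n_gt0 : (0 < n)%N) (d_gt0 : (0 < d)%N).
Implicit Types v : 'I_n -> 'cV[R]_d.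

Lemma weight_ge0 i j : 0 <= w i j.
Proof.
by have [_ w1 w0] := wP; have [/w1/ltW|/w0->] := boolP (E i j).
Qed.

Lemma sum_degl (f : 'I_n -> R) :
  \sum_i \sum_j w i j * f i = \sum_i deg w i * f i.
Proof. by apply: eq_bigr => i _; rewrite mulr_suml. Qed.

Lemma sum_degr (f : 'I_n -> R) :
  \sum_i \sum_j w i j * f j = \sum_i deg w i * f i.
Proof.
rewrite exchange_big -sum_degl; apply: eq_bigr => i _; apply: eq_bigr => j _.
by have [-> _ _] := wP.
Qed.

(** On an edge [rho i j] is an isometry; off the edges it is unconstrained, but the zero weight
    cancels every term. *)
Lemma edge_energy v i j :
  w i j * dot (v i - rho i j *m v j) (v i - rho i j *m v j) =
  w i j * dot (v i) (v i) + w i j * dot (v j) (v j)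
  - 2 * (w i j * dot (v i) (rho i j *m v j)).
Proof.
have [_ _ w0] := wP; have [Eij|/w0->] := boolP (E i j); last by rewrite !mul0r; ring.
by have [orth _] := rhoP Eij; rewrite dotB dot_orthogonal//; ring.
Qed.

Lemma sum_edge_energy v :
  \sum_i \sum_j w i j * dot (v i - rho i j *m v j) (v i - rho i j *m v j) =
  2 * energy w rho v.
Proof.
under eq_bigr do under eq_bigr do rewrite edge_energy.
under eq_bigr do rewrite big_split/= sumrN big_split/= -mulr_sumr.
rewrite big_split/= sumrN big_split/= -mulr_sumr.
rewrite (sum_degl (fun i => dot (v i) (v i))) (sum_degr (fun i => dot (v i) (v i))).
by rewrite /energy; ring.
Qed.

Lemma energy_ge0 v : 0 <= energy w rho v.
Proof.
rewrite -(pmulr_rge0 _ (ltr0n R 2)) -sum_edge_energy.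
by do 2![apply: sumr_ge0 => ? _]; rewrite mulr_ge0 ?weight_ge0 ?dot_ge0.
Qed.

Lemma frustrationE v : frustration w rho v = energy w rho v / mass w v.
Proof.
rewrite /frustration; under eq_bigr do under eq_bigr do rewrite enorm2_dot.
under [X in _ / X]eq_bigr do rewrite enorm2_dot.
by rewrite sum_edge_energy mulrA mulKf ?pnatr_eq0.
Qed.

Lemma mass_gt0 v : (exists i, v i <> 0) -> 0 < mass w v.
Proof.
move=> [i /eqP vi]; rewrite /mass (bigD1 i)//= ltr_pwDl//.
  by rewrite mulr_gt0// lt_neqAle eq_sym dot_eq0 vi dot_ge0.
by apply: sumr_ge0 => j _; rewrite mulr_ge0 ?dot_ge0// ltW.
Qed.

(** Scaling block [i] by the square root of [deg w i] cancels both factors [D1_invsqrt], so the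
    Rayleigh quotient at [y] is the frustration of [v]. A row vector is used because [eigenvalue]
    refers to left eigenvectors. *)
Lemma conn_laplacian_form v :
  let y := \mxrow_i (Num.sqrt (deg w i) *: (v i)^T) in
  (y *m conn_laplacian w rho *m y^T) 0 0 = energy w rho v /\
  (y *m y^T) 0 0 = mass w v.
Proof.
move=> y; have s0 i : Num.sqrt (deg w i) != 0 by rewrite sqrtr_eq0 -ltNge.
have yT : y^T = \mxcol_i (Num.sqrt (deg w i) *: v i).
  by rewrite tr_mxrow; apply/eq_mxcol => i; rewrite linearZ/= trmxK.
have yD : y *m D1_invsqrt d w = \mxrow_i (v i)^T.
  rewrite mul_mxrow_mxdiag; apply/eq_mxrow => i.
  by rewrite mul_mx_scalar scalerA mulVf// scale1r.
have Dy : D1_invsqrt d w *m y^T = \mxcol_i (v i).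
  rewrite yT mul_mxdiag_mxcol; apply/eq_mxcol => i.
  by rewrite mul_scalar_mx scalerA mulVf// scale1r.
have yy : (y *m y^T) 0 0 = mass w v.
  rewrite yT mul_mxrow_mxcol summxE; apply: eq_bigr => i _.
  by rewrite -scalemxAl -scalemxAr scalerA -expr2 sqr_sqrtr ?ltW// mxE.
split=> //; rewrite mulmxBr mulmxBl mulmx1 [LHS]mxE yy /energy; congr (_ + _).
rewrite !mulmxA yD -mulmxA Dy mul_mxrow_mxblock mul_mxrow_mxcol mxE summxE.
congr (- _); rewrite exchange_big; apply: eq_bigr => i _.
rewrite mulmx_suml summxE; apply: eq_bigr => j _.
by rewrite -scalemxAr -scalemxAl mxE /dot mulmxA.
Qed.

(** * Rounding to partial sphere maps *)

(** The right side is the integral over [u > 0] of energy minus [eta_star] times mass for the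
    rounded map [vu]; both the energy and the mass of [vu] are sums of indicators of levels. *)
Lemma eta_star_layer v :
  0 <= (1 - eta_star w rho) * mass w v
    - \sum_i \sum_j w i j * (dot (direction (v i)) (rho i j *m direction (v j))
        * Num.min (enorm (v i) ^+ 2) (enorm (v j) ^+ 2)).
Proof.
set eta := eta_star w rho; pose e i := direction (v i).
pose m i := enorm (v i) ^+ 2.
(* Vertices and ordered pairs share one index type, so that a single use of [layer_sum_ge0]
   integrates all terms. A pair survives up to the smaller of its two levels. *)
pose C (p : 'I_n + 'I_n * 'I_n) := match p with
  | inl i => (1 - eta) * deg w i
  | inr (i, j) => - (w i j * dot (e i) (rho i j *m e j)) end.
pose M (p : 'I_n + 'I_n * 'I_n) := match p with
  | inl i => m i | inr (i, j) => Num.min (m i) (m j) end.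
have -> : (1 - eta) * mass w v - \sum_i \sum_j w i j *
      (dot (direction (v i)) (rho i j *m direction (v j)) *
       Num.min (m i) (m j)) = \sum_p C p * M p.
  rewrite big_sumType/= mulr_sumr; congr (_ + _).
    by apply: eq_bigr => i _; rewrite mulrA /m enorm2_dot.
  rewrite pair_bigA -sumrN; apply: eq_bigr => -[i j] _ /=.
  by rewrite mulrA mulNr.
apply: layer_sum_ge0 => [[i|[i j]]|u u0]; rewrite /= ?le_min ?sqr_ge0//.
pose vu i := if u <= m i then e i else 0.
have vu1 i : dot (vu i) (vu i) = if u <= m i then 1 else 0.
  rewrite /vu; case: ifP => [ui|_]; last by apply/eqP; rewrite dot_eq0.
  apply: direction_unit; rewrite -enorm_eq0 -sqrf_eq0 gt_eqF//.
  exact: lt_le_trans ui.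
have -> : \sum_(p | u <= M p) C p = energy w rho vu - eta * mass w vu.
  rewrite /energy -/(mass w vu) big_sumType/= [LHS]addrC [RHS]addrAC addrC; congr (_ + _).
    rewrite -{1}[mass _ _]mul1r -mulrBl mulr_sumr big_mkcond/=.
    by apply: eq_bigr => i _; rewrite vu1; case: ifP; rewrite ?mulr0 ?mulr1.
  rewrite pair_bigA -sumrN big_mkcond/=; apply: eq_bigr => -[i j] _ /=.
  rewrite le_min /vu; case: ifP => [/andP[-> ->]//|].
  case: (u <= m i) => [/= ->|_]; last by rewrite /dot trmx0 mul0mx mxE mulr0 oppr0.
  by rewrite /dot !mulmx0 mxE mulr0 oppr0.
(* When [u] exceeds every level, [vu] is identically zero and not admissible for [eta_star]; its
   mass is then 0 and [energy_ge0] suffices. *)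
rewrite subr_ge0; have [vu0|vu0] := pselect (exists i, vu i <> 0).
  have vuP : partial_sphere_map vu.
    split=> // i; have := vu1 i; case: ifP => [_ d1|_ /eqP].
      by left; apply/eqP; rewrite -sqrp_eq1 ?enorm_ge0// enorm2_dot d1.
    by rewrite dot_eq0 => /eqP; right.
  have := (eta_star_min rho n_gt0 d_gt0 deg_gt0).2 _ vuP.
  by rewrite frustrationE ler_pdivlMr// mass_gt0.
rewrite (_ : mass w vu = 0) ?mulr0 ?energy_ge0// /mass big1// => i _.
have -> : vu i = 0 by apply: contrapT => vi; apply: vu0; exists i.
by rewrite /dot mulmx0 mxE mulr0.
Qed.

(** Summing [rounding_le] over the weighted edges bounds the integrated energy in
    [eta_star_layer]. *)
Lemma eta_star_le v t : 0 < t ->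
  eta_star w rho * mass w v <= t * energy w rho v + mass w v / t.
Proof.
move=> t0; have := eta_star_layer v; pose e i := direction (v i).
set S := (X in _ - X); set eta := eta_star w rho => etaS.
have pointwise i j : w i j * (enorm (v i) ^+ 2 + enorm (v j) ^+ 2
      - 2 * (dot (e i) (rho i j *m e j) *
             Num.min (enorm (v i) ^+ 2) (enorm (v j) ^+ 2)))
    <= w i j * (t * dot (v i - rho i j *m v j) (v i - rho i j *m v j)
         + (enorm (v i) ^+ 2 + enorm (v j) ^+ 2) / t).
  have [_ _ w0] := wP; have [Eij|/w0->] := boolP (E i j); last by rewrite !mul0r.
  have [orth _] := rhoP Eij; rewrite ler_wpM2l ?weight_ge0//.
  have /andP[k1 k2] : -1 <= dot (e i) (rho i j *m e j) <= 1.
    by apply: dot_le1; rewrite ?dot_orthogonal ?direction_le1.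
  rewrite dotB dot_orthogonal// -!enorm2_dot.
  have -> : dot (v i) (rho i j *m v j) =
      enorm (v i) * enorm (v j) * dot (e i) (rho i j *m e j).
    by rewrite {1}(directionE (v i)) {1}(directionE (v j)) -scalemxAr dotZl dotZr mulrA.
  apply: le_trans (rounding_le (enorm_ge0 _) (enorm_ge0 _) k1 k2 t0) _.
  (* The bound [(a + b) ^+ 2 <= 2 * (a ^+ 2 + b ^+ 2)] turns the remainder into a term that sums to
     a multiple of the mass. *)
  rewrite lerD2l invfM mulrA ler_pM2r ?invr_gt0// ler_pdivrMr//.
  have := sqr_ge0 (enorm (v i) - enorm (v j)); lra.
have sumD : \sum_i \sum_j w i j * (enorm (v i) ^+ 2 + enorm (v j) ^+ 2) = 2 * mass w v.
  under eq_bigr do under eq_bigr do rewrite mulrDr.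
  under eq_bigr do rewrite big_split/=.
  rewrite big_split/= (sum_degl (fun i => enorm (v i) ^+ 2)).
  rewrite (sum_degr (fun i => enorm (v i) ^+ 2)) /mass.
  by under eq_bigr do rewrite enorm2_dot; ring.
have : \sum_i \sum_j w i j * (enorm (v i) ^+ 2 + enorm (v j) ^+ 2
      - 2 * (dot (e i) (rho i j *m e j) *
             Num.min (enorm (v i) ^+ 2) (enorm (v j) ^+ 2)))
    <= \sum_i \sum_j w i j * (t * dot (v i - rho i j *m v j) (v i - rho i j *m v j)
         + (enorm (v i) ^+ 2 + enorm (v j) ^+ 2) / t).
  by do 2![apply: ler_sum => ? _]; exact: pointwise.
have -> : \sum_i \sum_j w i j * (enorm (v i) ^+ 2 + enorm (v j) ^+ 2
      - 2 * (dot (e i) (rho i j *m e j) *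
             Num.min (enorm (v i) ^+ 2) (enorm (v j) ^+ 2))) = 2 * mass w v - 2 * S.
  rewrite -sumD /S mulr_sumr -sumrB; apply: eq_bigr => i _.
  by rewrite mulr_sumr -sumrB; apply: eq_bigr => j _; ring.
have -> : \sum_i \sum_j w i j * (t * dot (v i - rho i j *m v j) (v i - rho i j *m v j)
         + (enorm (v i) ^+ 2 + enorm (v j) ^+ 2) / t) =
    t * (2 * energy w rho v) + 2 * mass w v / t.
  rewrite -sum_edge_energy -sumD mulr_sumr mulr_suml -big_split/=.
  apply: eq_bigr => i _; rewrite mulr_sumr mulr_suml -big_split/=.
  by apply: eq_bigr => j _; ring.
(* The summed bound controls [mass w v - S], which is at least [eta * mass w v] by [etaS]. *)
lra.
Qed.

(** * Comparison of [eta_star] with the smallest eigenvalue *)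

Lemma lambda_min_le_frustration v : (exists i, v i <> 0) ->
  lambda_min (conn_laplacian w rho) <= frustration w rho v.
Proof.
move=> /mass_gt0 v0; rewrite frustrationE ler_pdivlMr//.
have [<- <-] := conn_laplacian_form v; set y := \mxrow_i _.
have := lambda_min_rayleigh y^T (conn_laplacian_sym wP rhoP).
by rewrite /dot trmxK mulmxA.
Qed.

(** An eigenvector for the smallest eigenvalue is cut into blocks, and the scaling of
    [conn_laplacian_form] is undone. *)
Lemma lambda_min_attained :
  exists2 v, 0 < mass w v &
    energy w rho v = lambda_min (conn_laplacian w rho) * mass w v.
Proof.
have N0 : (0 < \sum_(i < n) d)%N by rewrite sum_nat_const card_ord muln_gt0 n_gt0.
have [/eigenvalueP[c cL c0] _] :=
  lambda_min_eigenvalue N0 (conn_laplacian_sym wP rhoP).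
pose v i := (Num.sqrt (deg w i))^-1 *: (submxrow c i)^T.
have cE : c = \mxrow_i (Num.sqrt (deg w i) *: (v i)^T).
  rewrite -[LHS]submxrowK; apply/eq_mxrow => i; rewrite linearZ/= trmxK scalerA.
  by rewrite mulfV ?scale1r// sqrtr_eq0 -ltNge.
have [En Ms] := conn_laplacian_form v; rewrite -cE in En Ms.
exists v; last by rewrite -En -Ms cL -scalemxAl mxE.
apply: mass_gt0; apply: contrapT => v0; move/eqP: c0; apply.
rewrite cE -[RHS]mxrow0; apply/eq_mxrow => i.
have -> : v i = 0 by apply: contrapT => vi; apply: v0; exists i.
by rewrite trmx0 scaler0.
Qed.

Lemma lambda_min_ge0 : 0 <= lambda_min (conn_laplacian w rho).
Proof.
have [v v0 vE] := lambda_min_attained.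
by rewrite -(pmulr_lge0 _ v0) -vE energy_ge0.
Qed.

Lemma eta_star_le_sqrt k : 4 <= k ->
  eta_star w rho <= Num.sqrt (k * lambda_min (conn_laplacian w rho)).
Proof.
move=> k4; have [eta0|eta0] := leP (eta_star w rho) 0.
  by apply: le_trans eta0 _; exact: sqrtr_ge0.
have [v v0 vE] := lambda_min_attained; have l0 := lambda_min_ge0.
(* The choice [t = 2 / eta] gives [eta <= 2 * l / eta + eta / 2], that is [eta ^+ 2 <= 4 * l]. It
   reaches the same constant as [t = 1 / sqrt l] without dividing by [l], which may be 0. *)
have := eta_star_le v (divr_gt0 (ltr0n R 2) eta0).
rewrite vE; move: (lambda_min _) l0 (eta_star w rho) eta0 => l l0 eta eta0.
rewrite mulrA [mass _ _ / _]mulrC -mulrDl ler_pM2r// => etale.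
have eta2 : eta ^+ 2 <= 4 * l.
  have : eta * eta <= (2 / eta * l + (2 / eta)^-1) * eta by rewrite ler_pM2r.
  have -> : (2 / eta * l + (2 / eta)^-1) * eta = 2 * l + eta ^+ 2 / 2.
    by field; rewrite gt_eqF.
  by rewrite -expr2; lra.
apply: le_trans (_ : Num.sqrt (eta ^+ 2) <= _).
  by rewrite sqrtr_sqr ler_norm.
by rewrite ler_wsqrtr// (le_trans eta2)// ler_wpM2r.
Qed.

End Energy.

Theorem theorem2p2 (R : realType) (n d : nat) (E : rel 'I_n)
    (w : 'I_n -> 'I_n -> R) (rho : 'I_n -> 'I_n -> 'M[R]_d)
    (n_gt0 : (0 < n)%N) (d_gt0 : (1 <= d)%N)
    (E_simple : simple_graph E) (w_weights : edge_weights E w)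
    (deg_gt0 : forall i, 0 < deg w i) (rho_conn : edge_connection E rho) :
  (lambda_min (conn_laplacian w rho) <= eta_star w rho
     <= Num.sqrt (10 * lambda_min (conn_laplacian w rho))) /\
  (d = 1%N ->
    eta_star w rho <= Num.sqrt (8 * lambda_min (conn_laplacian w rho))).
Proof.
have eta_le k := @eta_star_le_sqrt R n d E w rho w_weights rho_conn deg_gt0
  n_gt0 d_gt0 k.
split=> [|_]; last by apply: eta_le; lra.
apply/andP; split; last by apply: eta_le; lra.
have [[v [_ v0] <-] _] := eta_star_min rho n_gt0 d_gt0 deg_gt0.
exact: (lambda_min_le_frustration w_weights rho_conn deg_gt0 v0).
Qed.
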